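(* (i) (Setting (4.b)) There is a subgroup of $\mathbb{Z}^{\mathbb{N}}$ which is Hurewicz-bounded and Menger-bounded, has the Hurewicz property and the Menger property, but is not Rothberger-bounded and does not have the Rothberger property. (ii) (Setting (2.c)) There is a subgroup of $\mathbb{Z}^{\mathbb{N}}$ which is Menger-bounded and has the Menger property, but is not Hurewicz-bounded, is not Rothberger-bounded, does not have the Hurewicz property, and does not have the Rothberger property.
   Context: The group $\mathbb{Z}^{\mathbb{N}}$ carries pointwise addition and the product topology ($\mathbb{Z}$ discrete); subgroups carry the subspace topology. For a topological group $(G,\cdot)$, with the condition required for each sequence $(U_n)_{n\in\mathbb{N}}$ of neighborhoods of the unit: $G$ is Menger-bounded if there are finite $F_n\subseteq G$ with $G=\bigcup_n F_n\cdot U_n$; Hurewicz-bounded if there are finite $F_n\subseteq G$ such that each $g\in G$ belongs to $F_n\cdot U_n$ for all but finitely many $n$; Rothberger-bounded if there are $a_n\in G$ with $G=\bigcup_n a_n\cdot U_n$. For a topological space $X$, with the condition required for each sequence $(\mathcal{U}_n)_{n\in\mathbb{N}}$ of open covers of $X$: $X$ has the Menger property if there are finite $\mathcal{F}_n\subseteq\mathcal{U}_n$ such that $\bigcup_n\mathcal{F}_n$ covers $X$; the Hurewicz property if there are finite $\mathcal{F}_n\subseteq\mathcal{U}_n$ such that each $x\in X$ belongs to $\bigcup_{U\in\mathcal{F}_n}U$ for all but finitely many $n$; the Rothberger property if there are $U_n\in\mathcal{U}_n$ with $X=\bigcup_n U_n$. *)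

(* Defs.v *)
From HB Require Import structures.
From mathcomp Require Import all_boot all_order all_algebra.
From mathcomp Require Import all_classical all_reals all_analysis.

Set Implicit Arguments.
Unset Strict Implicit.
Unset Printing Implicit Defensive.

Import GRing.Theory.
Local Open Scope classical_set_scope.
Local Open Scope ring_scope.

Definition open_cover (X : topologicalType) (C : set (set X)) : Prop :=
  C `<=` open /\ \bigcup_(V in C) V = setT.

Definition Menger (X : topologicalType) : Prop :=
  forall C : nat -> set (set X), (forall n, open_cover (C n)) ->
  exists F : nat -> set (set X),
    (forall n, finite_set (F n) /\ F n `<=` C n) /\
    \bigcup_n \bigcup_(V in F n) V = setT.

Definition Hurewicz (X : topologicalType) : Prop :=
  forall C : nat -> set (set X), (forall n, open_cover (C n)) ->
  exists F : nat -> set (set X),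
    (forall n, finite_set (F n) /\ F n `<=` C n) /\
    forall x : X, \forall n \near \oo, (\bigcup_(V in F n) V) x.

Definition Rothberger (X : topologicalType) : Prop :=
  forall C : nat -> set (set X), (forall n, open_cover (C n)) ->
  exists V : nat -> set X,
    (forall n, C n (V n)) /\ \bigcup_n V n = setT.

(* The groups considered here are abelian, so the boundedness notions are
   written additively: [set f + u | f in F & u in U] is the product set F . U. *)

Definition Menger_bounded (G : topologicalZmodType) : Prop :=
  forall U : nat -> set G, (forall n, nbhs (0 : G) (U n)) ->
  exists F : nat -> set G,
    (forall n, finite_set (F n)) /\
    \bigcup_n [set f + u | f in F n & u in U n] = setT.

Definition Hurewicz_bounded (G : topologicalZmodType) : Prop :=
  forall U : nat -> set G, (forall n, nbhs (0 : G) (U n)) ->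
  exists F : nat -> set G,
    (forall n, finite_set (F n)) /\
    forall g : G, \forall n \near \oo, [set f + u | f in F n & u in U n] g.

Definition Rothberger_bounded (G : topologicalZmodType) : Prop :=
  forall U : nat -> set G, (forall n, nbhs (0 : G) (U n)) ->
  exists a : nat -> G, \bigcup_n [set a n + u | u in U n] = setT.

Lemma cvg_initial (S : choiceType) (T : topologicalType) (f : S -> T)
    (F : set_system S) (s : S) :
  Filter F -> f @ F --> f s -> F --> (s : initial_topology f).
Proof.
move=> FF Ffs A; rewrite nbhsE => -[_ [[B Bop <-] Bs] BA].
by apply: filterS BA _; apply: Ffs; exact: open_nbhs_nbhs.
Qed.

Lemma cvg_prod_topology (I : Type) (T : I -> topologicalType)
    (F : set_system (prod_topology T)) (f : prod_topology T) :
  Filter F -> (forall i, (fun g : prod_topology T => g i) @ F --> f i) ->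
  F --> f.
Proof. by move=> FF h; apply/cvg_sup => i; apply: cvg_initial; exact: h. Qed.

Section Subgroup.
Variables (M : topologicalZmodType) (S : zmodClosed M).

(* The subgroup S as a topological group in its own right, with the subspace
   topology, i.e. the initial topology for the inclusion into M. *)
Definition subgroup : Type := {x : M | x \in S}.

HB.instance Definition _ := SubChoice.on subgroup.
HB.instance Definition _ := [SubChoice_isSubZmodule of subgroup by <:].
HB.instance Definition _ :=
  Topological.copy subgroup (initial_topology (val : subgroup -> M)).

Lemma continuous_subgroup_val : continuous (val : subgroup -> M).
Proof. exact: initial_continuous. Qed.

Lemma subgroup_sub_continuous :
  continuous (fun x : subgroup * subgroup => x.1 - x.2).
Proof.
move=> x; apply: cvg_initial.
have : {for x, continuous (fun y : subgroup * subgroup => val y.1 - val y.2)}.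
  apply: (@continuous_comp _ _ _ (fun y : subgroup * subgroup =>
    (val y.1, val y.2)) (fun y : M * M => y.1 - y.2)).
  - apply: cvg_pair.
    + by apply: cvg_comp; [exact: cvg_fst | exact: continuous_subgroup_val].
    + by apply: cvg_comp; [exact: cvg_snd | exact: continuous_subgroup_val].
  - exact: sub_continuous.
exact.
Qed.

HB.instance Definition _ := PreTopologicalNmodule_isTopologicalZmodule.Build
  subgroup subgroup_sub_continuous.

End Subgroup.

(* [int] is wrapped in [discrete_topology] because the library puts no topology
   on it; the group structure on ZN is the pointwise one of [nat -> int]. *)
Definition ZN : Type := prod_topology (fun _ : nat => discrete_topology int).

HB.instance Definition _ := Topological.on ZN.
HB.instance Definition _ := GRing.Zmodule.copy ZN (nat -> int).

(* Filter instances are given explicitly below: left to unification, the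
   neighborhood filters of ZN get unfolded and the search does not end. *)
Lemma ZN_sub_continuous : continuous (fun x : ZN * ZN => x.1 - x.2).
Proof.
move=> x.
pose Z : topologicalType := discrete_topology int.
pose T := fun _ : nat => Z.
pose F : set_system (prod_topology T) := (fun x : ZN * ZN => x.1 - x.2) @ x.
have FF : Filter F.
  by refine (@fmap_filter _ _ _ _ (@nbhs_filter (ZN * ZN)%type x)).
refine (@cvg_prod_topology nat T F (x.1 - x.2) FF _) => i.
have pc : continuous (fun f : ZN => f i : Z).
  exact: (@proj_continuous nat T i).
have h1 : nbhs x [set y | y.1 i = x.1 i].
  refine (@cvg_comp _ _ _ fst (fun f : ZN => f i : Z) _ _ _
    cvg_fst (pc _) [set x.1 i] _).
  exact: (@discrete_set1 (discrete_topology int)).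
have h2 : nbhs x [set y | y.2 i = x.2 i].
  refine (@cvg_comp _ _ _ snd (fun f : ZN => f i : Z) _ _ _
    cvg_snd (pc _) [set x.2 i] _).
  exact: (@discrete_set1 (discrete_topology int)).
move=> A /nbhs_singleton Ax.
have h : nbhs x [set y | A (y.1 i - y.2 i)].
  refine (@filterS _ _ (@nbhs_filter _ x) _ _ _
    (@filterI _ _ (@nbhs_filter _ x) _ _ h1 h2)).
  move=> y [/= e1 e2].
  by rewrite e1 e2.
exact h.
Qed.

HB.instance Definition _ := PreTopologicalNmodule_isTopologicalZmodule.Build
  ZN ZN_sub_continuous.

(* Main.v *)
From HB Require Import structures.
Require Import Defs.
From mathcomp Require Import all_boot all_order all_algebra.
From mathcomp Require Import all_classical all_reals all_analysis.
From mathcomp Require Import wochoice zify.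

(* Both groups have the form B + <y_i : i in I>, where B is the sigma-compact
   group of bounded sequences. Since B contains {0,1}^N, such a group is never
   Rothberger-bounded, and for (i) B alone suffices.

   For (ii), let I be the bounding number b, as a well-order: every family of
   functions indexed by a proper initial segment of I is <=*-bounded, while some
   family indexed by I is not. A family (y_i) that is not <=*-bounded destroys
   Hurewicz-boundedness. If no family indexed by I is dominating (b < d), the
   group is covered by fewer than d translates of B and hence is Menger.
   Otherwise (b = d) take y_i to be a function with very sparse and very high
   spikes, both growing faster than all those of y_j, j < i. A combination of the
   y_i with large indices then has long initial segments on which it is small,
   so finite subfamilies of the covers that take care of g + B also take care
   of g + u + B for every combination u of y_i with i large. Iterating this
   along indices g_0 <= g_1 <= ... suffices, because the finite support of a
   given combination misses one of the intervals [g_j, g_(j+1)). *)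

Set Implicit Arguments.
Unset Strict Implicit.
Unset Printing Implicit Defensive.

Import Order.TTheory GRing.Theory.
Local Open Scope classical_set_scope.
Local Open Scope ring_scope.

(** * Small index sets and the bounding number *)

Definition eventually_le (f g : nat -> nat) :=
  \forall n \near \oo, (f n <= g n)%N.

Local Notation "f <=* g" := (eventually_le f g) (at level 70).

Lemma eventually_le_trans f g h : f <=* g -> g <=* h -> f <=* h.
Proof. by apply: filterS2 => n; exact: leq_trans. Qed.

Lemma eventually_leW f g : (forall n, f n <= g n)%N -> f <=* g.
Proof. by move=> fg; near=> n. Unshelve. all: by end_near. Qed.

(** Expresses without cardinals that [A] has fewer than b elements, where b is the bounding
    number. *)
Definition small (T : Type) (A : set T) :=
  forall phi : T -> nat -> nat, exists f, forall t, A t -> phi t <=* f.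

Lemma smallS (T : Type) (A B : set T) : A `<=` B -> small B -> small A.
Proof. by move=> AB sB phi; have [f Hf] := sB phi; exists f => t /AB /Hf. Qed.

(** Diagonalisation: at [n] take the maximum of the first [n] functions. *)
Lemma small_nat : small [set: nat].
Proof.
move=> phi; exists (fun n => \max_(i < n) phi i n) => t _.
near=> n; have tn : (t < n)%N by near: n; exact: nbhs_infty_gt.
exact: (@leq_bigmax _ (fun i : 'I_n => phi i n) (Ordinal tn)).
Unshelve. all: by end_near. Qed.

Lemma small_image (S T : Type) (A : set S) (h : S -> T) :
  small A -> small [set h s | s in A].
Proof.
move=> sA phi; have [f Hf] := sA (phi \o h).
by exists f => _ [s As <-]; exact: Hf.
Qed.

(** Regularity of b: bound each piece, then bound the family of bounds. *)
Lemma small_bigcup (S T : Type) (A : set S) (B : S -> set T) :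
  small A -> (forall s, A s -> small (B s)) -> small (\bigcup_(s in A) B s).
Proof.
move=> sA sB phi.
have /choice[F HF] : forall s, exists f, A s -> forall t, B s t -> phi t <=* f.
  move=> s; case: (pselect (A s)) => As; last by exists (fun=> 0).
  by have [f Hf] := sB s As phi; exists f.
have [f Hf] := sA F; exists f => t [s As Bst].
exact: eventually_le_trans (HF s As t Bst) (Hf s As).
Qed.

Lemma small_countable (T : countType) (A : set T) : small A.
Proof.
move=> phi.
have [f Hf] := small_nat (fun n => oapp phi (fun=> 0%N) (unpickle n)).
by exists f => t _; have := Hf (pickle t) I; rewrite pickleK.
Qed.

Lemma small_setU (T : Type) (A B : set T) :
  small A -> small B -> small (A `|` B).
Proof.
move=> sA sB; rewrite -bigcup2inE; apply: small_bigcup.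
  exact: small_countable.
by move=> [|[|//]].
Qed.

(** Words are built one letter at a time. Applied to an initial segment, this shows that fewer than
    b integer combinations use only indices below a given one. *)
Lemma small_words (T : eqType) (C : countType) (A : set T) :
  small A -> small [set w : seq (T * C) | {in w, forall x, A x.1}].
Proof.
move=> sA; pose B n := [set w : seq (T * C) |
  size w = n /\ {in w, forall x, A x.1}].
suff sB n : small (B n).
  apply: (@smallS _ _ (\bigcup_n B n)); last exact: small_bigcup small_nat _.
  by move=> w Aw; exists (size w).
elim: n => [|n IHn].
  apply: (@smallS _ _ [set [::] | _ in [set: unit]]).
    by move=> w [/size0nil -> _]; exists tt.
  by apply: small_image; exact: small_countable.
apply: (@smallS _ _ (\bigcup_(t in A) \bigcup_(c in [set: C])
  [set (t, c) :: w | w in B n])); last first.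
  apply: small_bigcup => // t At; apply: small_bigcup => [|c _].
    exact: small_countable.
  exact: small_image.
move=> [|[t c] w] [//= [sw] Aw]; exists t.
  by apply: (Aw (t, c)); rewrite mem_head.
by exists c => //; exists w => //; split=> // x xw; apply: Aw; rewrite inE xw orbT.
Qed.

Lemma not_small_functions : ~ small [set: nat -> nat].
Proof.
move=> /(_ id)[f /(_ (S \o f) I)] /filter_ex[n] /=.
by rewrite ltnn.
Qed.

(** * Well-orders as order types *)

Section WellOrder.
Variables (T : choiceType) (R : rel T).

(** The proof is a phantom argument, so that the order instance on this alias of [T] can depend on
    it. *)
Definition well_ordered of well_order R : Type := T.

Variable Rwo : well_order R.
Local Notation W := (well_ordered Rwo).

HB.instance Definition _ := Choice.copy W T.

Let wo_total : total R.
Proof.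
move=> x y; have [|z [[]]] := Rwo (A := pred2 x y).
  by exists x; rewrite !inE eqxx.
rewrite !inE => /orP[] /eqP -> Rz _.
  by rewrite Rz ?inE ?eqxx ?orbT.
by rewrite orbC Rz ?inE ?eqxx ?orbT.
Qed.

Let wo_refl : reflexive R.
Proof. by move=> x; have := wo_total x x; rewrite orbb. Qed.

(** The minimum of a pair is unique, so two mutually related points coincide. *)
Let wo_anti : antisymmetric R.
Proof.
move=> x y /andP[xy yx]; have [|z [_ zP]] := Rwo (A := pred2 x y).
  by exists x; rewrite !inE eqxx.
rewrite -(zP x) ?(zP y) //; split; rewrite ?inE ?eqxx ?orbT // => t;
  by rewrite !inE => /orP[] /eqP->.
Qed.

Let wo_trans : transitive R.
Proof.
move=> y x z xy yz; have [|t [[]]] := Rwo (A := pred3 x y z).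
  by exists x; rewrite !inE eqxx.
rewrite !inE => /or3P[] /eqP -> Rt _.
- by rewrite Rt ?inE ?eqxx ?orbT.
- have yx : R y x by rewrite Rt ?inE ?eqxx ?orbT.
  by rewrite (@wo_anti x y) ?xy ?yx.
- have zy : R z y by rewrite Rt ?inE ?eqxx ?orbT.
  by rewrite (@wo_anti z y) ?zy ?yz.
Qed.

HB.instance Definition _ := @Order.isOrder.Build Order.default_display
  W R (fun x y => (y != x) && R x y) _ _
  (fun x y => erefl) (fun x y => erefl) (fun x y => erefl)
  wo_anti wo_trans wo_total.

Lemma well_ordered_min (A : set W) :
  A !=set0 -> exists2 x, A x & forall y, A y -> (x <= y)%O.
Proof.
move=> [a Aa]; have [|x [[Ax xmin] _]] := Rwo (A := [pred t | `[< A t >]]).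
  by exists a; apply/asboolP.
by exists x => [|y Ay]; [exact/asboolP | apply: xmin; exact/asboolP].
Qed.

End WellOrder.

Section BoundingOrder.
Variables (R : rel (nat -> nat)) (Rwo : well_order R).
Local Notation W := (well_ordered Rwo).

(** The points with small initial segment form the initial segment of order type b. *)
Definition small_initial : Type :=
  {x : W | `[< small [set y : W | (y < x)%O] >]}.

Local Notation I := small_initial.

HB.instance Definition _ := SubChoice.on I.
HB.instance Definition _ :=
  [SubChoice_isSubOrder of I by <: with Order.default_display].

Lemma small_initial_wf : well_founded (<%O : rel I).
Proof.
move=> i; apply: contrapT => Ni.
have [|x [y Ny <-] ymin] :=
    @well_ordered_min _ _ Rwo [set val j | j in [set j : I | ~ Acc <%O j]].
  by exists (val i), i.
apply: Ny; constructor => z zy; apply: contrapT => Nz.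
by have := ymin _ (ex_intro2 _ _ z Nz erefl); rewrite leNgt; case/negP.
Qed.

Lemma small_initial_lt (i : I) : small [set j | (j < i)%O].
Proof.
have /asboolP sm := valP i => phi.
have [f Hf] := sm (fun x : W => oapp phi (fun=> 0%N) (insub x)).
by exists f => t ti; have := Hf (val t) ti; rewrite valK.
Qed.

(** If some initial segment is not small, the least such one lies in the image of [I]; otherwise [I]
    exhausts all functions, which are not small. *)
Lemma small_initial_not_small : ~ small [set: I].
Proof.
move=> /(small_image val) smI.
case: (pselect (exists x : W, ~ small [set y | (y < x)%O])) => [[x Nx]|all_small].
  have [|z Nz zmin] := @well_ordered_min _ _ Rwo
    [set x | ~ small [set y : W | (y < x)%O]]; first by exists x.
  apply: Nz; apply: smallS smI => y yz.
  have /asboolP sy : small [set t : W | (t < y)%O].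
    by apply: contrapT => /zmin; rewrite leNgt; case/negP.
  by exists (Sub y sy) => //; rewrite SubK.
apply: not_small_functions; apply: smallS smI => y _.
have /asboolP sy : small [set t : W | (t < y)%O].
  by apply: contrapT => Ny; apply: all_small; exists y.
by exists (Sub y sy) => //; rewrite SubK.
Qed.

End BoundingOrder.

Lemma bounding_order : exists (d : Order.disp_t) (I : orderType d),
  [/\ well_founded (<%O : rel I), (forall i : I, small [set j | (j < i)%O]) &
      ~ small [set: I]].
Proof.
have [R Rwo] := well_ordering_principle (nat -> nat).
exists Order.default_display, (small_initial Rwo); split.
- exact: small_initial_wf.
- exact: small_initial_lt.
- exact: small_initial_not_small.
Qed.

(** * Sparse functions *)

(** Well-founded recursion with a choice at each stage, for a requirement that looks only at earlier
    values. *)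
Lemma wf_choice (I V : Type) (lt : I -> I -> Prop) (v0 : V)
    (R : I -> (I -> V) -> V -> Prop) :
  well_founded lt ->
  (forall i Y Z v, (forall j, lt j i -> Y j = Z j) -> R i Y v -> R i Z v) ->
  (forall i Y, exists v, R i Y v) ->
  exists Y, forall i, R i Y (Y i).
Proof.
move=> wf Rext Rtot.
have /choice[F HF] : forall i, exists F : (I -> V) -> V, forall Y, R i Y (F Y).
  by move=> i; have [F HF] := choice (Rtot i); exists F.
(* Values at indices not below [i] are filled with [v0]; [Rext] makes this harmless. *)
pose G i (rec : forall j, lt j i -> V) :=
  F i (fun j => if pselect (lt j i) is left ji then rec j ji else v0).
exists (Fix wf (fun=> V) G) => i.
rewrite Fix_eq; last first.
  move=> k f g fg; rewrite /G; congr (F k _); apply/funext => j.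
  by case: pselect.
by apply: Rext (HF i _) => j ji; case: pselect.
Qed.

Section Spikes.
Variable D : nat -> nat.

(* The spikes are at 0, leap 0, leap (leap 0), ...: the one at m has height
   v = D m and the next one is at D (v ^ 4), which leaves room for multiples of
   the function and of D. *)
Definition leap (m : nat) := D ((D m) ^ 4).

Definition spike (i : nat) : int :=
  if `[< exists j, i = iter j leap 0%N >] then (D i)%:Z else 0.

Lemma spike_iter j : spike (iter j leap 0) = D (iter j leap 0).
Proof.
by rewrite /spike; case: asboolP => // -[]; exists j.
Qed.

Hypothesis D_homo : {homo D : m n / (m <= n)%N}.
Hypothesis D_gt : forall n, (n < D n)%N.

Lemma leap_gt m : (m < leap m)%N.
Proof.
rewrite /leap; apply: leq_trans (D_gt m) _; apply: leq_trans (ltnW (D_gt _)).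
by rewrite -[X in (X <= _)%N]expn1 leq_pexp2l // (leq_ltn_trans _ (D_gt m)).
Qed.

Lemma leap_homo : {homo leap : m n / (m <= n)%N}.
Proof. by move=> m n mn; apply/D_homo; rewrite leq_exp2r //; exact: D_homo. Qed.

Lemma iter_leap_homo : {homo (fun j => iter j leap 0%N) : j k / (j <= k)%N}.
Proof. by apply: homo_leq => // [? ? ?|j]; [exact: leq_trans | exact/ltnW/leap_gt]. Qed.

Lemma iter_leap_ge j : (j <= iter j leap 0)%N.
Proof. by elim: j => // j IHj; exact: leq_ltn_trans IHj (leap_gt _). Qed.

(** Let p be the first spike position with p >= k, and v = D p. Spikes up to p have height at most
    v, and the next one is at D (v ^ 4). A spike preceding p lies below k, so p <= leap k. *)
Lemma spike_quiet k : exists v, [/\ (k < v)%N, (D (v ^ 4) <= leap (leap k))%N &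
  forall i, (i < D (v ^ 4))%N -> (`|spike i| <= v)%N].
Proof.
have [|j kj jmin] := @ex_minnP (fun j => k <= iter j leap 0)%N.
  by exists k; exact: iter_leap_ge.
exists (D (iter j leap 0)); split.
- exact: leq_ltn_trans kj (D_gt _).
- apply: leap_homo; case: j jmin {kj} => // j jmin /=.
  by apply: leap_homo; rewrite leqNgt; apply/negP => /ltnW /jmin; rewrite ltnn.
move=> i ij; rewrite /spike; case: asboolP => //= -[l il].
have lj : (l <= j)%N.
  rewrite leqNgt; apply/negP => /iter_leap_homo; rewrite -il /=.
  by rewrite leqNgt ij.
by rewrite il; apply/D_homo/iter_leap_homo.
Qed.

End Spikes.

Section Combinations.
Variables (I : eqType) (y : I -> nat -> int).

Definition combination (w : seq (I * int)) (n : nat) : int :=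
  \sum_(x <- w) x.2 * y x.1 n.

Lemma combination_cat w1 w2 n :
  combination (w1 ++ w2) n = combination w1 n + combination w2 n.
Proof. exact: big_cat. Qed.

Lemma combination_opp w n :
  combination [seq (x.1, - x.2) | x <- w] n = - combination w n.
Proof.
by rewrite /combination big_map -sumrN; apply: eq_bigr => x _; rewrite mulNr.
Qed.

Lemma combination_filter (P : pred I) w n :
  combination w n = combination [seq x <- w | P x.1] n +
                    combination [seq x <- w | ~~ P x.1] n.
Proof. by rewrite /combination !big_filter (bigID (fun x => P x.1)). Qed.

End Combinations.

Lemma seq_max (d : Order.disp_t) (I : orderType d) (C : eqType) (w : seq (I * C)) :
  w != [::] -> exists2 b, b \in w & {in w, forall x, (x.1 <= b.1)%O}.
Proof.
elim: w => // a w IHw _; have [->|/IHw[b bw bmax]] := eqVneq w [::].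
  by exists a => [|x]; rewrite ?mem_head // inE => /eqP->.
have [ab|ba] := leP a.1 b.1.
  exists b => [|x]; first by rewrite inE bw orbT.
  by rewrite inE => /orP[/eqP-> //|/bmax].
exists a => [|x]; first exact: mem_head.
by rewrite inE => /orP[/eqP-> //|/bmax /le_trans]; apply; exact: ltW.
Qed.

(** There is no largest index: otherwise [I] would be a small initial segment with one point
    added. *)
Lemma words_lt_bound (d : Order.disp_t) (I : orderType d) (C : eqType) :
  (forall i : I, small [set j | (j < i)%O]) -> ~ small [set: I] ->
  forall (g : I) (w : seq (I * C)),
    exists2 b, (g < b)%O & {in w, forall x, (x.1 < b)%O}.
Proof.
move=> ltS NS.
have above (i : I) : exists j, (i < j)%O.
  apply: contrapT => Ni; apply: NS.
  apply: (@smallS _ _ ([set j | (j < i)%O] `|` [set i])); last first.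
    apply: small_setU => // phi.
    by exists (phi i) => _ ->; exact: eventually_leW.
  move=> j _; have [ji|ij|->] := ltgtP j i; [by left | | by right].
  by case: Ni; exists j.
move=> g; elim=> [|a w [b gb wb]]; first by have [b gb] := above g; exists b.
have [c bac] := above (Order.max b a.1); move: bac; rewrite gt_max => /andP[bc ac].
exists c => [|x]; first exact: lt_trans bc.
by rewrite inE => /orP[/eqP-> //|/wb xb]; exact: lt_trans bc.
Qed.

Section SpacedFamily.
Variables (d : Order.disp_t) (I : orderType d).
Hypothesis I_wf : well_founded (<%O : rel I).
Hypothesis I_lt_small : forall i : I, small [set j | (j < i)%O].

Lemma spaced_family (dom : I -> nat -> nat) : exists D : I -> nat -> nat,
  forall i, [/\ {homo D i : m n / (m <= n)%N}, forall n, (n < D i n)%N,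
    dom i <=* D i &
    forall j, (j < i)%O -> (fun k => leap (D j) (leap (D j) k)) <=* D i].
Proof.
apply: (@wf_choice I (nat -> nat) (fun i j => (i < j)%O) (fun=> 0%N)
  (fun i D v => [/\ {homo v : m n / (m <= n)%N}, forall n, (n < v n)%N,
    dom i <=* v & forall j, (j < i)%O ->
    (fun k => leap (D j) (leap (D j) k)) <=* v])) => // [i Y Z v YZ|i D].
  by case=> ? ? ? H; split=> // j ji; rewrite -YZ //; exact: H.
have [f Hf] := I_lt_small i (fun j k => leap (D j) (leap (D j) k)).
(* The cumulative sum is monotone, its last term carries [dom i] and [f], and [n.+1] lifts it above
   the identity. *)
exists (fun n => n.+1 + \sum_(t < n.+1) (dom i t + f t))%N; split.
- apply: homo_leq => // [? ? ?|n]; first exact: leq_trans.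
  by rewrite [X in (_ <= _ + X)%N]big_ord_recr /=; lia.
- by move=> n; rewrite leq_addr.
- by apply: eventually_leW => n; rewrite big_ord_recr /=; lia.
move=> j ji; apply: eventually_le_trans (Hf j ji) _.
by apply: eventually_leW => n; rewrite big_ord_recr /=; lia.
Qed.

Variable D : I -> nat -> nat.
Hypothesis D_homo : forall i, {homo D i : m n / (m <= n)%N}.
Hypothesis D_gt : forall i n, (n < D i n)%N.
Hypothesis D_lt : forall i j, (j < i)%O ->
  (fun k => leap (D j) (leap (D j) k)) <=* D i.

Let y i := spike (D i).

Lemma spaced_le i j : (j <= i)%O -> D j <=* D i.
Proof.
rewrite le_eqVlt => /orP[/eqP -> | /D_lt]; first exact: eventually_leW.
apply: eventually_le_trans; apply: eventually_leW => n.
apply: (@leq_trans (leap (D j) n)); last exact/ltnW/leap_gt.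
apply: D_homo; apply: (leq_trans (ltnW (D_gt j n))).
by rewrite -[X in (X <= _)%N]expn1 leq_pexp2l // (leq_ltn_trans _ (D_gt j n)).
Qed.

(* Induction on the largest index b' occurring in w: the gap of [spike (D b')]
   following a spike is so long that it contains a quiet stretch of the rest. *)
Lemma combination_quiet_lt (g b : I) (w : seq (I * int)) (c : nat) :
  (g <= b)%O -> {in w, forall x, (g <= x.1 < b)%O} ->
  \forall k \near \oo, exists n, [/\ (k <= n)%N, (D g (c * n) <= D b (k ^ 2))%N &
    forall i, (i < D g (c * n))%N -> (`|combination y w i| <= n)%N].
Proof.
elim/(well_founded_ind I_wf): b w c => b IHb w c gb gwb.
have [->|/seq_max[[b' c'] b'w /= b'max]] := eqVneq w [::].
  have [k0 _ Hk0] := spaced_le gb.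
  near=> k; exists k; split=> // [|i _]; last by rewrite /combination big_nil.
  have ck : (c <= k)%N by near: k; exact: nbhs_infty_ge.
  apply: (@leq_trans (D g (k ^ 2))).
    by apply: D_homo; rewrite -mulnn leq_mul2r ck orbT.
  by apply: Hk0; rewrite /=; have : (k0 <= k)%N; [near: k; exact: nbhs_infty_ge | nia].
have /= /andP[gb' b'b] := gwb _ b'w.
pose w' := [seq x <- w | (x.1 < b')%O].
have gw' : {in w', forall x, (g <= x.1 < b')%O}.
  by move=> x; rewrite mem_filter => /andP[-> /gwb /andP[->]].
(* By maximality the remaining letters all have index [b'], so [C] is the total coefficient of
   [y b']. *)
pose C : int := \sum_(x <- w | ~~ (x.1 < b')%O) x.2.
have wE i : combination y w i = combination y w' i + C * y b' i.
  rewrite (combination_filter _ (fun j => j < b')%O) -/w'; congr (_ + _).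
  rewrite /combination big_filter mulr_suml big_seq_cond [RHS]big_seq_cond.
  apply: eq_bigr => x /andP[xw]; rewrite -leNgt => b'x.
  by have /= xb' := b'max _ xw; rewrite (@le_anti _ _ x.1 b') // xb' b'x.
(* The factor 2 prepares for the final witness [2 * n]: one [n] for [w'], one for the multiple of
   [y b']. *)
have [k0 _ Hk0] := IHb b' b'b w' (2 * c)%N gb' gw'.
have [k1 _ Hk1] := D_lt b'b.
near=> k.
have [v [kv vk vq]] := spike_quiet (@D_homo b') (@D_gt b') k.
have kk0 : (k0 <= k)%N by near: k; exact: nbhs_infty_ge.
have kk1 : (k1 <= k)%N by near: k; exact: nbhs_infty_ge.
have Ck : (`|C| <= k)%N by near: k; exact: nbhs_infty_ge.
have vv : (v <= v ^ 2)%N by nia.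
(* Started at [v ^ 2], the induction window ends by [D b' (v ^ 4)], inside the quiet stretch of
   [y b'], where the multiple by [C] is at most [v ^ 2 <= n]. *)
have [|n [vn Dn nq]] := Hk0 (v ^ 2)%N; first by rewrite /=; lia.
have cn : (c * (2 * n) = 2 * c * n)%N by lia.
have v4 : ((v ^ 2) ^ 2 = v ^ 4)%N by rewrite -expnM.
rewrite v4 in Dn.
exists (2 * n)%N; split; first by lia.
  rewrite cn; apply: (leq_trans Dn); apply: (leq_trans vk).
  apply: (@leq_trans (D b k)); first by apply: Hk1.
  by apply: D_homo; nia.
move=> i; rewrite cn wE => ilt.
have := nq i ilt; have := vq i (leq_trans ilt Dn); rewrite -/(y b') => h1 h2.
have h3 : (`|(C * y b' i)%R| <= v ^ 2)%N.
  by rewrite abszM -mulnn leq_mul // (leq_trans Ck) // ltnW.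
by move: h2 h3; move: (combination y w' i) (C * y b' i)%R => s t; lia.
Unshelve. all: by end_near. Qed.

Hypothesis I_not_small : ~ small [set: I].

Lemma combination_quiet (g : I) (w : seq (I * int)) (k : nat) :
  {in w, forall x, (g <= x.1)%O} ->
  exists n, (k <= n)%N /\
    forall i, (i < D g n)%N -> (`|combination y w i| <= n)%N.
Proof.
move=> gw; have [b gb wb] := words_lt_bound I_lt_small I_not_small g w.
have [|k0 _ Hk0] := @combination_quiet_lt g b w 1 (ltW gb).
  by move=> x xw; rewrite gw ?wb.
have [|n [kn _ nq]] := Hk0 (maxn k0 k); first exact: leq_maxl.
exists n; rewrite mul1n in nq; split=> //.
by apply: leq_trans kn; rewrite leq_maxr.
Qed.

End SpacedFamily.

(** * Covers of subgroups of Z^N *)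

Section SubgroupTopology.
Variable S : zmodClosed ZN.
Local Notation G := (subgroup S).

Definition entry (x : G) : nat -> int := val x.

Lemma open_cylinder (V : set G) (x : G) : open V -> V x ->
  exists l, forall z : G, (forall i, (i < l)%N -> entry z i = entry x i) -> V z.
Proof.
move=> Vo Vx.
(* The filter of sets containing a cylinder around [x] converges to [x], entry by entry. *)
pose F : set_system G := [set A | exists l, forall z : G,
  (forall i, (i < l)%N -> entry z i = entry x i) -> A z].
have FF : Filter F.
  split=> [|A B [l Al] [m Bm]|A B AB [l Al]]; first by exists 0%N.
    exists (maxn l m) => z zx; split; [apply: Al|apply: Bm] => i ilm;
      by apply: zx; rewrite leq_max ilm ?orbT.
  by exists l => z /Al /AB.
suff : F --> x by apply; exact: open_nbhs_nbhs.
refine (@cvg_initial G ZN val F x FF _).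
refine (@cvg_prod_topology nat (fun=> discrete_topology int) (val @ F) (val x)
  (@fmap_filter _ _ _ _ FF) _) => i A /nbhs_singleton Ax.
by exists i.+1 => z zx; have := zx i (ltnSn i); rewrite /entry /= => ->.
Qed.

Lemma nbhs0_entry n : nbhs (0 : G) [set x | entry x n = 0].
Proof.
have pc : continuous (fun f : ZN => f n : discrete_topology int).
  exact: (@proj_continuous nat (fun=> discrete_topology int) n).
refine (@continuous_subgroup_val _ S 0 [set f : ZN | f n = 0] _).
refine (pc _ [set 0] _).
exact: (@discrete_set1 (discrete_topology int)).
Qed.

End SubgroupTopology.

(** * From covering properties to boundedness *)

Section Boundedness.
Variable G : topologicalZmodType.

(** A covering property applied to such covers yields the matching boundedness. The member around
    [x] is the translate by [x] of the interior of [U]. *)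
Lemma translate_open_cover (U : set G) : nbhs (0 : G) U ->
  open_cover [set V : set G | open V /\ exists a : G, V `<=` [set a + u | u in U]].
Proof.
move=> U0; split=> [V []//|]; rewrite -subTset => x _.
exists [set y | interior U (y - x)]; last first.
  by rewrite /= subrr.
split.
  apply: (@open_comp G G (fun y => y - x)); last exact: open_interior.
  move=> y _.
  apply: (@continuous_comp G (G * G)%type G (fun y => (y, x)) (fun z => z.1 - z.2)).
    by apply: cvg_pair; [exact: cvg_id | exact: cvg_cst].
  exact: sub_continuous.
exists x => y /= /interior_subset Uyx; exists (y - x) => //.
by rewrite addrC subrK.
Qed.

Lemma translates_cover (U : set G) (F : set (set G)) : finite_set F ->
  (forall V, F V -> exists a : G, V `<=` [set a + u | u in U]) ->
  exists A, finite_set A /\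
    \bigcup_(V in F) V `<=` [set a + u | a in A & u in U].
Proof.
move=> Ffin FU.
have /choice[a Ha] : forall V, exists a : G, F V -> V `<=` [set a + u | u in U].
  move=> V; case: (pselect (F V)) => [/FU[a Ha]|]; last by exists 0.
  by exists a.
exists (a @` F); split=> [|x [V FV Vx]]; first exact: finite_image.
by have [u Uu <-] := Ha V FV x Vx; exists (a V); [exists V | exists u].
Qed.

Lemma Menger_Menger_bounded : Menger G -> Menger_bounded G.
Proof.
move=> M U U0; have [F [FC FT]] := M _ (fun n => translate_open_cover (U0 n)).
have /choice[A HA] n : exists A, finite_set A /\
    \bigcup_(V in F n) V `<=` [set a + u | a in A & u in U n].
  by have [Ffin FU] := FC n; apply: translates_cover Ffin _ => V /FU[].
exists A; split=> [n|]; first by have [] := HA n.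
rewrite -subTset -FT => x [n _ Fx]; exists n => //.
by have [_] := HA n; exact.
Qed.

Lemma Hurewicz_Hurewicz_bounded : Hurewicz G -> Hurewicz_bounded G.
Proof.
move=> H U U0; have [F [FC FT]] := H _ (fun n => translate_open_cover (U0 n)).
have /choice[A HA] n : exists A, finite_set A /\
    \bigcup_(V in F n) V `<=` [set a + u | a in A & u in U n].
  by have [Ffin FU] := FC n; apply: translates_cover Ffin _ => V /FU[].
exists A; split=> [n|x]; first by have [] := HA n.
by apply: filterS (FT x) => n; have [_] := HA n; exact.
Qed.

Lemma Rothberger_Rothberger_bounded : Rothberger G -> Rothberger_bounded G.
Proof.
move=> H U U0; have [V [VC VT]] := H _ (fun n => translate_open_cover (U0 n)).
have /choice[a Ha] n : exists a : G, V n `<=` [set a + u | u in U n].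
  by have [] := VC n.
by exists a; rewrite -subTset -VT => x [n _ Vx]; exists n => //; exact: Ha.
Qed.

End Boundedness.

Lemma Hurewicz_Menger (X : topologicalType) : Hurewicz X -> Menger X.
Proof.
move=> H C Co; have [F [FC FH]] := H C Co; exists F; split=> //.
by rewrite -subTset => x _; have [n Fnx] := filter_ex (FH x); exists n.
Qed.

Section Negative.
Variable S : zmodClosed ZN.
Local Notation G := (subgroup S).

(** With [U n] the elements vanishing at [n], all of f + [U n] shares its entry at [n] with f; [h n]
    bounds these entries over the finite set [F n]. *)
Lemma Hurewicz_bounded_dominated : Hurewicz_bounded G ->
  exists h : nat -> nat, forall x : G, (fun n => `|entry x n|%N) <=* h.
Proof.
move=> /(_ _ (@nbhs0_entry S))[F [Ffin HF]].
have /choice[h Hh] n : exists m, forall x, F n x -> (`|entry x n| <= m)%N.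
  have /finite_seqP[A ->] := Ffin n.
  exists (\max_(x <- A) `|entry x n|)%N => x /= xA.
  exact: (@leq_bigmax_seq _ A xpredT (fun x => `|entry x n|%N) x xA).
exists h => x; apply: filterS (HF x) => n [f Ff [u un <-]].
have -> : entry (f + u) n = entry f n + entry u n by [].
by rewrite un addr0; exact: Hh.
Qed.

Lemma Rothberger_bounded_guessed : Rothberger_bounded G ->
  exists a : nat -> int, forall x : G, exists n, entry x n = a n.
Proof.
move=> /(_ _ (@nbhs0_entry S))[a Ha]; exists (fun n => entry (a n) n) => x.
have [n _ [u un <-]] : (\bigcup_n [set a n + u | u in [set x | entry x n = 0]]) x.
  by rewrite Ha.
have e : entry (a n + u) n = entry (a n) n + entry u n by [].
by exists n; rewrite e un addr0.
Qed.

End Negative.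

Section CompactCover.
Variable S : zmodClosed ZN.
Local Notation G := (subgroup S).
Hypothesis S_bounded : forall (x : G) (z : ZN) (r : nat),
  (forall n, `|(z n : int) - entry x n| <= r)%N -> z \in S.

Let agree (s : seq int) (x : G) := mkseq (entry x) (size s) = s.

(* Koenig's lemma replaces the compactness of [x : |x - g| <= r]. *)
Lemma compact_subcover (C : set (set G)) : open_cover C ->
  exists F : nat -> set (set G),
  [/\ forall m, finite_set (F m) /\ F m `<=` C,
      forall m p, (m <= p)%N -> F m `<=` F p &
      forall (g : G) (r : nat), exists e, forall l (x : G), (e <= l)%N ->
        (forall i, (i < l)%N -> `|entry x i - entry g i| <= r)%N ->
        (\bigcup_(V in F l) V) x].
Proof.
move=> [Co CT].
have /choice[V HV] (s : seq int) : exists V, 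
    (exists W, C W /\ forall x, agree s x -> W x) ->
    C V /\ forall x, agree s x -> V x.
  case: (pselect (exists W, C W /\ forall x, agree s x -> W x)) => [[W HW]|].
    by exists W.
  by exists set0.
pose secured s := exists W, C W /\ forall x, agree s x -> W x.
(* [F] depends on neither [g] nor [r]: it collects the sets chosen for words with code below [m]
   whose cylinder lies in a member of [C]. *)
pose F m := [set V s | s in [set s | (pickle s < m)%N /\ secured s]].
exists F; split=> [m|m p mp _ [s [sm ss] <-]|g r].
- split=> [|_ [s [_ /HV[CV _]] <-] //].
  apply: finite_image; apply: (@sub_finite_set _ _ [set s | (pickle s < m)%N]).
    by move=> s [].
  apply: (@finite_preimage _ _ [set n | (n < m)%N] (pickle : seq int -> nat)).
    by move=> s t _ _; exact: (pcan_inj pickleK).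
  exact: finite_II.
- by exists s => //; split=> //; exact: leq_trans mp.
pose near_g l (x : G) := forall i, (i < l)%N -> (`|entry x i - entry g i| <= r)%N.
pose good s := exists e, forall l (x : G), (e <= l)%N -> near_g l x ->
  agree s x -> (\bigcup_(V in F l) V) x.
suff [e He] : good [::] by exists e => l x el xl; exact: He.
apply: contrapT => bad0.
(* Only [2 * r + 1] letters are within [r] of [g]; if all these extensions were good, so would be
   [s]. *)
have step s : ~ good s -> exists z,
    ~ good (rcons s z) /\ (`|z - entry g (size s)| <= r)%N.
  move=> bads; apply: contrapT => /forallNP N; apply: bads.
  have good_r z : (`|z - entry g (size s)| <= r)%N -> good (rcons s z).
    by move=> zr; apply: contrapT => badz; apply: (N z).
  have /choice[e He] (k : nat) : exists e, (k <= 2 * r)%N ->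
      forall l (x : G), (e <= l)%N -> near_g l x ->
      agree (rcons s (entry g (size s) - r%:Z + k%:Z)) x ->
      (\bigcup_(V in F l) V) x.
    case: (leqP k (2 * r)) => [kr|]; last by exists 0%N.
    by have [|e He] := good_r (entry g (size s) - r%:Z + k%:Z);
      [lia | exists e].
  (* The bound [(size s).+1] makes [near_g] constrain the entry at [size s]. *)
  exists (maxn (size s).+1 (\max_(k < (2 * r).+1) e k)) => l x.
  rewrite geq_max => /andP[sl el] xl sx.
  have /= xr := xl _ sl.
  pose k := `|(entry x (size s) - entry g (size s) + r%:Z)%R|%N.
  have kr : (k < (2 * r).+1)%N by rewrite /k; lia.
  apply: (He k) => //.
    by apply: leq_trans el; exact: (@leq_bigmax _ (fun i : 'I__ => e i) (Ordinal kr)).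
  rewrite /agree size_rcons mkseqS; congr rcons; first exact: sx.
  by rewrite /k; lia.
have /choice[next Hnext] s : exists z, ~ good s ->
    ~ good (rcons s z) /\ (`|z - entry g (size s)| <= r)%N.
  case: (pselect (good s)) => [gs|/step[z Hz]]; last by exists z.
  by exists 0.
(* A branch of bad words; its limit [z] stays within [r] of [g], hence in [S]. *)
pose br := fix br n := if n is m.+1 then rcons (br m) (next (br m)) else [::].
pose z : ZN := fun n => next (br n).
have brE n : br n = mkseq z n by elim: n => //= n IHn; rewrite mkseqS -IHn.
have bad n : ~ good (br n).
  by elim: n => //= n IHn; have [] := Hnext _ IHn.
have zS : z \in S.
  apply: (S_bounded (x := g) (r := r)) => n.
  by have [_] := Hnext _ (bad n); rewrite {2}brE size_mkseq.
pose x : G := exist _ z zS.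
have [W CW Wx] : (\bigcup_(W in C) W) x by rewrite CT.
have [l Hl] := open_cylinder (Co _ CW) Wx.
(* The cylinder of [br l] lies in [W], so [F] covers it from its code on and [br l] is good. *)
apply: (bad l); exists (pickle (br l)).+1 => m t bm _ bt.
have sec : secured (br l).
  exists W; split=> // u; rewrite /agree brE size_mkseq => eu.
  by apply: Hl => i il; rewrite -(nth_mkseq 0 (entry u) il) eu nth_mkseq.
by exists (V (br l)); [exists (br l) | have [_] := HV _ sec; exact].
Qed.

End CompactCover.

(** * Groups generated by the bounded sequences and a family *)

Section BoundedSpan.
Variables (I : eqType) (y : I -> nat -> int).

(** Words may repeat indices, so that sums of combinations are concatenations. *)
Definition bounded_span : {pred ZN} := fun x => `[< exists w M,
  forall n, (`|(x n : int) - combination y w n| <= M)%N >].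

Lemma bounded_span_closed : zmod_closed bounded_span.
Proof.
split=> [|x z /asboolP[w [M xw]] /asboolP[v [N zv]]]; apply/asboolP.
  by exists [::], 0%N => n; rewrite /combination big_nil.
exists (w ++ [seq (t.1, - t.2) | t <- v]), (M + N)%N => n.
rewrite combination_cat combination_opp.
have -> : ((x - z) n : int) = (x n : int) - (z n : int) by [].
by have := xw n; have := zv n; lia.
Qed.

HB.instance Definition _ :=
  GRing.isZmodClosed.Build ZN bounded_span bounded_span_closed.

Local Notation G := (subgroup bounded_span).

Lemma bounded_span_near (x : G) (z : ZN) (r : nat) :
  (forall n, `|(z n : int) - entry x n| <= r)%N -> z \in bounded_span.
Proof.
move=> zx; have /asboolP[w [M xw]] := valP x; apply/asboolP.
by exists w, (r + M)%N => n; have := zx n; have := xw n; rewrite /entry; lia.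
Qed.

Lemma combination_in_span w : (combination y w : ZN) \in bounded_span.
Proof. by apply/asboolP; exists w, 0%N => n; rewrite subrr. Qed.

Definition span_combination w : G :=
  exist (fun x : ZN => x \in bounded_span) _ (combination_in_span w).

(** A 0-1 sequence can differ from a given [a] at every place. *)
Lemma bounded_span_not_Rothberger_bounded : ~ Rothberger_bounded G.
Proof.
move=> /Rothberger_bounded_guessed[a Ha].
pose z : ZN := fun n => if a n == 0 then 1 else 0.
have zS : z \in bounded_span.
  apply/asboolP; exists [::], 1%N => n.
  by rewrite /combination big_nil subr0 /z; case: eqP.
have [n] := Ha (exist (fun x : ZN => x \in bounded_span) z zS); rewrite /entry /= /z.
by case: eqP => [->|/[swap] <-].
Qed.

Lemma bounded_span_not_Hurewicz_bounded :
  (forall h, exists i, ~ (fun n => `|y i n|%N) <=* h) -> ~ Hurewicz_bounded G.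
Proof.
move=> yN /Hurewicz_bounded_dominated[h Hh]; have [i] := yN h; apply.
have := Hh (span_combination [:: (i, 1)]); apply: filterS => n.
by rewrite /entry /= /combination big_seq1 mul1r.
Qed.

(** The thresholds [e] depend on [w] alone. The radius [2 * n] eventually absorbs any constant error
    plus a further error [n]. *)
Lemma bounded_span_subcover (C : nat -> set (set G)) :
  (forall n, open_cover (C n)) -> exists F : nat -> nat -> set (set G),
  [/\ forall n m, finite_set (F n m) /\ F n m `<=` C n,
      forall n m p, (m <= p)%N -> F n m `<=` F n p &
      forall w, exists e : nat -> nat, forall n l (x : G), (e n <= l)%N ->
        (forall i, (i < l)%N -> `|entry x i - combination y w i| <= 2 * n)%N ->
        (\bigcup_(V in F n l) V) x].
Proof.
move=> Co.
have /choice[F HF] n := compact_subcover bounded_span_near (Co n).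
exists F; split=> [n m|n|w]; try by have [] := HF n.
have /choice[e He] n : exists e, forall l (x : G), (e <= l)%N ->
        (forall i, (i < l)%N -> `|entry x i - combination y w i| <= 2 * n)%N ->
        (\bigcup_(V in F n l) V) x.
  by have [_ _ /(_ (span_combination w) (2 * n)%N)] := HF n.
by exists e.
Qed.

Lemma bounded_span_bounded (x : G) : exists w M,
  forall n, (`|entry x n - combination y w n| <= M)%N.
Proof. by have /asboolP[w [M xw]] := valP x; exists w, M. Qed.

End BoundedSpan.

(** Without generators, each [x] is bounded by some [M], and [F n (e n)] catches it for all
    [n >= M]. *)
Lemma bounded_span_Hurewicz (y : void -> nat -> int) :
  Hurewicz (subgroup (bounded_span y)).
Proof.
move=> C /bounded_span_subcover[F [FC _ FH]]; have [e He] := FH [::].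
exists (fun n => F n (e n)); split=> // x.
have [[|[[]]] [M xM]] := bounded_span_bounded x.
exists M => // n /= Mn; apply: He => // i _; apply: leq_trans (xM i) _.
by lia.
Qed.

(** * Menger groups with an unbounded generating family *)

Section UnboundedMenger.
Variables (d : Order.disp_t) (I : orderType d).
Hypothesis I_wf : well_founded (<%O : rel I).
Hypothesis I_lt_small : forall i : I, small [set j | (j < i)%O].
Hypothesis I_not_small : ~ small [set: I].

Lemma words_lt_dominated (e : seq (I * int) -> nat -> nat) :
  exists f : I -> nat -> nat, forall i w, {in w, forall x, (x.1 < i)%O} -> e w <=* f i.
Proof.
have /choice[f Hf] i := small_words (C := int) (I_lt_small i) e.
by exists f.
Qed.

Lemma nonempty_index : exists i : I, True.
Proof.
apply: contrapT => /forallNP NI; apply: I_not_small => phi.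
by exists id => i; case: (NI i).
Qed.

(** Let [f i] bound the thresholds of all words below [i]. A function [h] dominated by no [f i]
    exceeds the threshold of each word infinitely often. *)
Lemma Menger_no_dominating (y : I -> nat -> int) :
  (forall f : I -> nat -> nat, exists g, forall i, ~ g <=* f i) ->
  Menger (subgroup (bounded_span y)).
Proof.
move=> nodom C /bounded_span_subcover[F [FC Fmono /choice[e He]]].
have [f Hf] := words_lt_dominated e.
have [h Hh] := nodom f.
exists (fun n => F n (h n)); split=> //; rewrite -subTset => x _.
have [w [M xw]] := bounded_span_bounded x.
have [i0 _] := nonempty_index.
have [b _ wb] := words_lt_bound I_lt_small I_not_small i0 w.
have [k0 _ Hk0] := Hf b w wb.
have [n [kn fh]] : exists n, (maxn k0 M <= n)%N /\ (f b n < h n)%N.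
  apply: contrapT => /forallNP N; apply: (Hh b).
  exists (maxn k0 M) => // n kn; rewrite leqNgt; apply/negP => fh.
  by apply: (N n).
exists n => //; apply: (He w).
  by apply: leq_trans (ltnW fh); apply: Hk0; rewrite /=; lia.
by move=> i _; apply: leq_trans (xw i) _; lia.
Qed.

Lemma Menger_dominating (D : I -> nat -> nat) :
  (forall i, {homo D i : m n / (m <= n)%N}) -> (forall i n, (n < D i n)%N) ->
  (forall i j, (j < i)%O -> (fun k => leap (D j) (leap (D j) k)) <=* D i) ->
  (forall h, exists i, h <=* D i) ->
  Menger (subgroup (bounded_span (fun i => spike (D i)))).
Proof.
move=> D_homo D_gt D_lt D_dom C /bounded_span_subcover[F [FC Fmono /choice[e He]]].
have [f Hf] := words_lt_dominated e.
(* [D (next i)] outgrows the bound [f i] for the thresholds of words below [i]. The countably many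
   [f (g j)] met along the iteration get a common bound [h]. *)
have /choice[next Hnext] i : exists j, (i <= j)%O /\ f i <=* D j.
  have [j Hj] := D_dom (f i); exists (Order.max i j).
  rewrite le_max lexx; split=> //; apply: eventually_le_trans Hj _.
  by apply: (spaced_le D_homo D_gt D_lt); rewrite le_max lexx orbT.
have [i0 _] := nonempty_index.
pose g j := iter j next i0.
have g_homo : {homo g : j k / (j <= k)%N >-> (j <= k)%O}.
  apply: homo_leq => [j|j k l|j]; [exact: lexx | exact: le_trans |].
  by have [] := Hnext (g j).
have [h Hh] := small_nat (f \o g).
exists (fun n => F n (h n)); split=> //; rewrite -subTset => x _.
have [w [M xw]] := bounded_span_bounded x.
(* A finite support misses one of the intervals [g j, g j.+1). *)
have [j jw] : exists j, {in w, forall t, (t.1 < g j)%O \/ (g j.+1 <= t.1)%O}.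
  suff : \forall j \near \oo, {in w, forall t, (t.1 < g j)%O \/ (g j.+1 <= t.1)%O}.
    by move=> /filter_ex.
  elim: w {xw} => [|t w IHw]; first by near=> j.
  have ht : \forall j \near \oo, (t.1 < g j)%O \/ (g j.+1 <= t.1)%O.
    case: (pselect (exists k, (t.1 < g k)%O)) => [[k tk]|N].
      by exists k => // j kj; left; apply: lt_le_trans tk _; exact: g_homo.
    near=> j; right; rewrite leNgt; apply/negP => tj; apply: N.
    by exists j.+1.
  apply: filterS2 ht IHw => j tj wj s.
  by rewrite inE => /orP[/eqP->|/wj].
pose w1 := [seq t <- w | (t.1 < g j)%O]; pose w2 := [seq t <- w | ~~ (t.1 < g j)%O].
have [k1 _ Hk1] : e w1 <=* f (g j).
  by apply: Hf => t; rewrite mem_filter => /andP[].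
have [k2 _ Hk2] := (Hnext (g j)).2.
have [k3 _ Hk3] := Hh j Logic.I.
(* Before place [f (g j) n <= D (g j.+1) n] the part [w2] is at most [n], so there [x] differs from
   the combination of [w1] by at most [M + n <= 2 * n]. *)
have [|n [kn nq]] := combination_quiet I_wf I_lt_small D_homo D_gt D_lt I_not_small
    (g := g j.+1) (w := w2) (M + k1 + k2 + k3).
  move=> t; rewrite mem_filter => /andP[/negbTE tj tw].
  by have [|//] := jw t tw; rewrite tj.
exists n => //.
have [V FV Vx] : (\bigcup_(V in F n (f (g j) n)) V) x; last first.
  exists V => //; apply: Fmono FV; apply: Hk3; rewrite /=; lia.
apply: (He w1); first by apply: Hk1; rewrite /=; lia.
move=> i il.
have /nq : (i < D (g j.+1) n)%N.
  by apply: leq_trans il _; apply: Hk2; rewrite /=; lia.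
have := xw i; rewrite (combination_filter _ (fun t => t < g j)%O) -/w1 -/w2.
move: (entry x i) (combination _ w1 i) (combination _ w2 i) => a b c.
lia.
Unshelve. all: by end_near. Qed.

(** A dominating family indexed by [I] is turned into sparse spikes; if there is none, any unbounded
    family serves. *)
Lemma unbounded_Menger_span : exists y : I -> nat -> int,
  Menger (subgroup (bounded_span y)) /\
  forall h, exists i, ~ (fun n => `|y i n|%N) <=* h.
Proof.
case: (pselect (exists dom : I -> nat -> nat, forall h, exists i, h <=* dom i)).
  move=> [dom Hdom].
  have [D HD] := spaced_family I_wf I_lt_small dom.
  have D_homo i := (let: And4 p _ _ _ := HD i in p).
  have D_gt i := (let: And4 _ p _ _ := HD i in p).
  have D_dom i := (let: And4 _ _ p _ := HD i in p).
  have D_lt i := (let: And4 _ _ _ p := HD i in p).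
  have D_dominating h : exists i, h <=* D i.
    by have [i Hi] := Hdom h; exists i; exact: eventually_le_trans (D_dom i).
  exists (fun i => spike (D i)); split.
    exact: Menger_dominating.
  (* At a spike [n] the value is [D i n], which eventually exceeds [h n]; spikes occur arbitrarily
     far out. *)
  move=> h; have [i [k0 _ Hk0]] := D_dominating (S \o h).
  exists i => -[k1 _ Hk1]; pose n := iter (k0 + k1) (leap (D i)) 0%N.
  have nk : (k0 + k1 <= n)%N by exact: iter_leap_ge.
  have /= := Hk0 n; have /= := Hk1 n; rewrite spike_iter -/n /=; lia.
move=> nodom.
have [phi Hphi] : exists phi : I -> nat -> nat, forall h, exists i, ~ phi i <=* h.
  apply: contrapT => /forallNP N; apply: I_not_small => phi.
  have /existsNP[h Hh] := N phi; exists h => i _.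
  by apply: contrapT => Ni; apply: Hh; exists i.
exists (fun i n => (phi i n)%:Z); split; last exact: Hphi.
apply: Menger_no_dominating => f; apply: contrapT => /forallNP N.
apply: nodom; exists f => h; have /existsNP[i /contrapT Hi] := N h.
by exists i.
Qed.

End UnboundedMenger.

Theorem theorem9p2 :
  (exists S : zmodClosed ZN,
     Hurewicz_bounded (subgroup S) /\ Menger_bounded (subgroup S) /\
     Hurewicz (subgroup S) /\ Menger (subgroup S) /\
     ~ Rothberger_bounded (subgroup S) /\ ~ Rothberger (subgroup S)) /\
  (exists S : zmodClosed ZN,
     Menger_bounded (subgroup S) /\ Menger (subgroup S) /\
     ~ Hurewicz_bounded (subgroup S) /\ ~ Rothberger_bounded (subgroup S) /\
     ~ Hurewicz (subgroup S) /\ ~ Rothberger (subgroup S)).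
Proof.
split.
  (* The empty index type leaves only the bounded sequences. *)
  pose y (i : void) (n : nat) : int := 0.
  exists [the zmodClosed ZN of bounded_span y].
  have H := @bounded_span_Hurewicz y; have M := Hurewicz_Menger H.
  have NR := @bounded_span_not_Rothberger_bounded _ y.
  split; first exact: Hurewicz_Hurewicz_bounded.
  split; first exact: Menger_Menger_bounded.
  by do 3 split=> //; move=> /Rothberger_Rothberger_bounded.
have [d [I [I_wf I_lt_small I_not_small]]] := bounding_order.
have [y [M yN]] := unbounded_Menger_span I_wf I_lt_small I_not_small.
have NR := @bounded_span_not_Rothberger_bounded _ y.
have NH := bounded_span_not_Hurewicz_bounded yN.
exists [the zmodClosed ZN of bounded_span y]; split; first exact: Menger_Menger_bounded.
do 3 split=> //; split=> [/Hurewicz_Hurewicz_bounded|/Rothberger_Rothberger_bounded] //.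
Qed.
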